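(* There exists an $egr(32,5,5,12)$, that is, a $5$-regular simple graph with $32$ vertices and girth $5$ in which every edge is contained in exactly $12$ distinct $5$-cycles.
   Context: All graphs are simple (no loops, no multiple edges). An $egr(v,k,g,\lambda)$ (edge-girth-regular graph) is a $k$-regular graph of order (number of vertices) $v$ and girth $g$ such that each of its edges is contained in exactly $\lambda$ distinct $g$-cycles (cycles of length $g$). *)

(* Defs.v *)
From mathcomp Require Import all_boot.

Set Implicit Arguments.
Unset Strict Implicit.
Unset Printing Implicit Defensive.

Definition simple_graph (T : finType) (e : rel T) : Prop :=
  symmetric e /\ irreflexive e.

Definition regular (T : finType) (e : rel T) (k : nat) : Prop :=
  forall x : T, #|[set y | e x y]| = k.

(* A cycle is identified with the set of its edges {x, next s x}, so that the
   rotations and reflections of a closed vertex sequence s count only once. *)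
Definition cycle_edges (T : finType) (s : seq T) : {set {set T}} :=
  [set [set x; next s x] | x in s].

(* The bound 2 < n excludes the degenerate closed sequences x and x, y, which
   satisfy [path.cycle] and are not cycles of a simple graph. *)
Definition graph_cycles (T : finType) (e : rel T) (n : nat) :
    {set {set {set T}}} :=
  [set C | (2 < n) &&
    [exists t : n.-tuple T, [&& uniq t, cycle e t & C == cycle_edges t]]].

Definition has_girth (T : finType) (e : rel T) (g : nat) : Prop :=
  graph_cycles e g != set0 /\ forall n, n < g -> graph_cycles e n = set0.

Definition egr (T : finType) (e : rel T) (v k g lambda : nat) : Prop :=
  [/\ simple_graph e, #|T| = v, regular e k, has_girth e g
    & forall x y : T, e x y ->
        #|[set C in graph_cycles e g | [set x; y] \in C]| = lambda].

(* Main.v *)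
Require Import Defs.
From mathcomp Require Import all_boot.

Set Implicit Arguments.
Unset Strict Implicit.
Unset Printing Implicit Defensive.

(** The graph is built from the affine plane over the field F4 = {0, 1, w, w+1}
    by deleting the vertical lines.  Its 16 points (x, y) and the 16 remaining
    lines y = m x + b form a bipartite 4-regular incidence graph of girth 6,
    since two points lie on at most one line, and on none when they have the
    same x.  Joining (x, y) to (x, y + 1) and the line (m, b) to the parallel
    line (m, b + w) adds a perfect matching on either side; the result is
    5-regular on 32 vertices.

    Every cycle has an even number of incidence edges, and no two matching edges
    are consecutive.  A triangle would thus put two points of equal x on one
    line, or dually two parallel lines through one point.  A 4-cycle would be
    made of a matched pair of points incident with a matched pair of lines,
    which would force 1 = w.  So the girth is at least 5, and a 5-cycle has
    exactly one matching edge.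

    Take a matched pair of points p, p'.  A 5-cycle through the edge p p' is
    given by one of the 4 lines through p and one of the 3 other points r of
    that line, because r and p' have different x and so are on a unique line.
    This gives 12 cycles, and dually 12 for matched lines.  The 16 matching edges
    account for 192 cycles, each with 4 of the 64 incidence edges; translations
    and shears (x, y) |-> (x, y + r x) preserve both matchings and act
    transitively on incidence edges, so each of these is in 192 * 4 / 64 = 12
    cycles.  For a field of even order q the two counts are q (q - 1) and
    4 (q - 1): they agree only for q = 4.

    In the formal proof these counts are checked by computation.  Cycles are
    sets of edges, which cannot be enumerated efficiently, so the mathematical
    content is [card_cycles_through]: the n-cycles through an edge x y correspond
    bijectively to the paths on n vertices that start with x, y and close up.
    Such paths are listed from the neighbour lists of the graph, and
    [closing_walks_neighbours] counts them for each edge. *)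

(** * Cycles as sets of edges *)

Section CycleEdges.

Variable T : finType.
Implicit Types (s t : seq T) (a b x y z : T) (e : rel T).

Lemma mem_cycle_edges s a b :
  a \in s -> next s a = b -> [set a; b] \in cycle_edges s.
Proof. by move=> sa <-; apply: imset_f. Qed.

Lemma cycle_edges_rot s i : uniq s -> cycle_edges (rot i s) = cycle_edges s.
Proof.
move=> Us; apply/setP=> E.
by apply/imsetP/imsetP=> -[a]; rewrite ?mem_rot => sa ->;
  exists a; rewrite ?mem_rot ?next_rot.
Qed.

Lemma cycle_edges_rev s : uniq s -> cycle_edges (rev s) = cycle_edges s.
Proof.
move=> Us; apply/setP=> E; apply/imsetP/imsetP=> -[a]; rewrite ?mem_rev => sa ->.
  exists (prev s a); first by rewrite mem_prev.
  by rewrite next_rev // next_prev // setUC.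
exists (next s a); first by rewrite mem_rev mem_next.
by rewrite next_rev // prev_next // setUC.
Qed.

(** A cycle meets each of its vertices in two edges only.  This lets its
    vertex sequence be recovered from its edge set, up to direction. *)
Lemma cycle_edgesP s a b : uniq s -> a \in s ->
  [set a; b] \in cycle_edges s -> b = next s a \/ b = prev s a.
Proof.
move=> Us sa /imsetP[c sc] /setP Eab.
have := Eab a; rewrite !inE eqxx /= => /esym/orP[] /eqP ac.
  subst c; have := Eab b; have := Eab (next s a).
  rewrite !inE !eqxx !orbT => /orP[] /eqP.
    by move=> -> /esym/orP[] /eqP ->; left.
  by move=> -> _; left.
right; rewrite ac prev_next //; move: Eab; rewrite -ac => Eab.
have := Eab b; have := Eab c; rewrite !inE !eqxx !orbT /=.
case/orP=> /eqP-> //; rewrite orbb => /esym/eqP; exact.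
Qed.

(** This is where closed sequences of length 2 have to be excluded: there the two
    edges at a vertex coincide. *)
Lemma next_next_neq s a : uniq s -> 2 < size s -> a \in s ->
  next s (next s a) != a.
Proof.
move=> Us s2 sa; case: (rot_to sa) => i t st.
rewrite -!(next_rot i Us); move: s2 Us; rewrite -(size_rot i) -(rot_uniq i) st.
case: t {st} => [|b [|c t]] // _ /andP[]; rewrite !inE !negb_or.
by case/and3P=> ab ac _ _; rewrite /= eqxx (eq_sym b) (negPf ab) eqxx eq_sym.
Qed.

Lemma cycle_traject s x : uniq (x :: s) ->
  x :: s = traject (next (x :: s)) x (size s).+1.
Proof.
move=> Us; have := cycle_next Us; rewrite /= rcons_path => /andP[+ _].
case/fpathP=> n sE; have sn : size s = n by rewrite sE size_traject.
by rewrite sn /= -sE.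
Qed.

(** Fixing the first two vertices fixes both the starting point and the direction,
    so the edge set determines the rest: once the cycle has arrived at b from a,
    it must leave b by the only other edge at b. *)
Lemma cycle_edges_inj x y s t :
  uniq [:: x, y & s] -> uniq [:: x, y & t] -> 0 < size s -> size s = size t ->
  cycle_edges [:: x, y & s] = cycle_edges [:: x, y & t] -> s = t.
Proof.
set s' := [:: x, y & s]; set t' := [:: x, y & t] => Us Ut s_gt0 st eqC.
have eq_next n : [/\ iter n (next s') x = iter n (next t') x,
    iter n (next s') x \in s', iter n (next s') x \in t' &
    next s' (iter n (next s') x) = next t' (iter n (next s') x)].
  elim: n => [|n]; first by rewrite /= !inE !eqxx.
  rewrite !iterS => -[<-]; set a := iter n _ x => sa ta eqn; split=> //.
  - by rewrite mem_next.
  - by rewrite eqn mem_next.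
  set b := next s' a; have sb : b \in s' by rewrite mem_next.
  have tb : b \in t' by rewrite /b eqn mem_next.
  (* The edge from b to its successor in s' also belongs to t', so that successor
     is the one in t' or is a again, and the latter would be turning back. *)
  have : [set b; next s' b] \in cycle_edges t' by rewrite -eqC mem_cycle_edges.
  case/(cycle_edgesP Ut tb) => //; rewrite /b {2}eqn prev_next // => nna.
  by have := next_next_neq Us s_gt0 sa; rewrite nna eqxx.
suff: s' = t' by case.
rewrite /s' /t' (cycle_traject Us) (cycle_traject Ut) /= -st.
apply: (@eq_from_nth _ x) => [|i]; rewrite /= ?size_traject // => lti.
rewrite -/(traject _ x (size s).+2) -[in RHS]/(traject _ x (size s).+2).
by rewrite !nth_traject //; case: (eq_next i).
Qed.

(** Rotating, and reversing if necessary, makes a cycle start with any prescribed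
    one of its edges, in either direction. *)
Lemma cycle_edges_normal e s x y : symmetric e ->
  uniq s -> cycle e s -> 1 < size s -> [set x; y] \in cycle_edges s ->
  exists t, [/\ uniq [:: x, y & t], cycle e [:: x, y & t],
    (size t).+2 = size s & cycle_edges [:: x, y & t] = cycle_edges s].
Proof.
move=> e_sym Us es s1 sxy.
have sx : x \in s.
  case/imsetP: (sxy) => a sa /setP/(_ x); rewrite !inE eqxx.
  by case/esym/orP=> /eqP -> //; rewrite mem_next.
have start s' : uniq s' -> cycle e s' -> 1 < size s' -> x \in s' ->
    y = next s' x -> exists t, [/\ uniq [:: x, y & t], cycle e [:: x, y & t],
      (size t).+2 = size s' & cycle_edges [:: x, y & t] = cycle_edges s'].
  move=> Us' es' s'1 s'x ->; case: (rot_to s'x) => i t st.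
  rewrite -(next_rot i Us') -(cycle_edges_rot i Us') -(size_rot i) st.
  move: Us' es' s'1; rewrite -(rot_uniq i) -(rot_cycle i) -(size_rot i) st.
  by case: t {st} => [//|b t] /=; rewrite eqxx; exists t.
case: (cycle_edgesP Us sx sxy) => yE; first exact: start.
have [||||| t [? ? ? ?]] := start (rev s).
- by rewrite rev_uniq.
- by rewrite rev_cycle (eq_cycle (e' := e)) // => a b; apply: e_sym.
- by rewrite size_rev.
- by rewrite mem_rev.
- by rewrite next_rev.
by exists t; split=> //; rewrite ?size_rev -?(cycle_edges_rev Us) -?(size_rev s).
Qed.

End CycleEdges.

(** * Counting cycles by listing walks *)

(** The graph is given by neighbour lists, so that the lists of walks below
    can be evaluated. *)
Section Walks.

Variables (T : finType) (nbrs : T -> seq T).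
Let e : rel T := fun x y => y \in nbrs x.

(** The starting vertex is left out of the sequences listed. *)
Fixpoint walks n x : seq (seq T) :=
  if n is n'.+1 then [seq y :: p | y <- nbrs x, p <- walks n' y] else [:: [::]].

(** The edge back to x is tested first because most walks fail this cheaper
    test. *)
Definition closing_walks x n y : seq (seq T) :=
  [seq p <- walks n y | e (last y p) x && uniq [:: x, y & p]].

Lemma mem_walks n x p : (p \in walks n x) = (size p == n) && path e x p.
Proof.
elim: n x p => [|n IHn] x p; first by case: p.
apply/allpairsPdep/idP => [[y [q [xy]]]|].
  by rewrite IHn => /andP[qn yq] ->; rewrite /= eqSS qn yq andbT.
case: p => [//|y q] /andP[qn /andP[xy yq]].
by exists y, q; rewrite IHn -eqSS qn.
Qed.

Hypothesis nbrs_uniq : forall x, uniq (nbrs x).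

Lemma uniq_walks n x : uniq (walks n x).
Proof.
elim: n x => [//|n IHn] x; apply: allpairs_uniq_dep => // -[y p] [z q] _ _ /=.
by case=> -> ->.
Qed.

Lemma mem_closing_walks x n y p : e x y -> (p \in closing_walks x n y) =
  [&& size p == n, uniq [:: x, y & p] & cycle e [:: x, y & p]].
Proof.
move=> xy; rewrite mem_filter mem_walks /= xy rcons_path.
by rewrite andbC -andbA; congr (_ && _); rewrite andbA andbC.
Qed.

Lemma graph_cycles_eq0 n :
  (forall x y, e x y -> closing_walks x n y = [::]) -> graph_cycles e n.+2 = set0.
Proof.
move=> no_walk; apply/setP=> C; rewrite !inE; apply/negP=> /andP[_].
case/existsP=> -[[|x [|y p]] //= psize] /and3P[Up ep _].
have xy : e x y by case/andP: ep.
have : p \in closing_walks x n y by rewrite mem_closing_walks //; apply/and3P.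
by rewrite no_walk.
Qed.

(** The edge set map is injective on closing walks by [cycle_edges_inj] and
    reaches every cycle through x y by [cycle_edges_normal]. *)
Lemma card_cycles_through n x y : symmetric e -> e x y ->
  #|[set C in graph_cycles e n.+3 | [set x; y] \in C]| =
    size (closing_walks x n.+1 y).
Proof.
move=> e_sym xy; pose edges p := cycle_edges [:: x, y & p].
rewrite -(size_map edges) -(card_uniqP _); last first.
  rewrite map_inj_in_uniq ?filter_uniq ?uniq_walks // => p q.
  rewrite !mem_closing_walks // => /and3P[/eqP pn Up _] /and3P[/eqP qn Uq _].
  by apply: cycle_edges_inj; rewrite ?pn ?qn.
apply: eq_card => C; rewrite !inE; apply/idP/mapP.
  case/andP=> /existsP[t /and3P[Ut et /eqP ->]] txy.
  have [|p [Up ep psize <-]] := cycle_edges_normal e_sym Ut et _ txy.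
    by rewrite size_tuple.
  exists p => //; rewrite mem_closing_walks // Up ep andbT.
  by move: psize; rewrite size_tuple => -[->]; rewrite eqxx.
case=> p; rewrite mem_closing_walks // => /and3P[pn Up ep] ->.
have tsize : size [:: x, y & p] == n.+3 by [].
apply/andP; split; first by apply/existsP; exists (Tuple tsize); rewrite Up ep /=.
by apply: mem_cycle_edges; rewrite ?mem_head //= eqxx.
Qed.

End Walks.

(** * The affine plane of order 4 with two matchings *)

(** The pair (a, b) stands for a + b w, where w ^ 2 = w + 1. *)
Definition F4 : finType := (bool * bool)%type.

Definition F4_add (a b : F4) : F4 := (a.1 (+) b.1, a.2 (+) b.2).

Definition F4_mul (a b : F4) : F4 :=
  ((a.1 && b.1) (+) (a.2 && b.2),
   (a.1 && b.2) (+) (a.2 && b.1) (+) (a.2 && b.2)).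

Definition F4_elements : seq F4 :=
  [:: (false, false); (true, false); (false, true); (true, true)].

(** [(false, (x, y))] is the point (x, y) and [(true, (m, b))] is the line
    y = m x + b. *)
Definition vertex : finType := (bool * (F4 * F4))%type.

Definition vertices : seq vertex :=
  [seq (s, p) | s <- [:: false; true],
                p <- [seq (x, y) | x <- F4_elements, y <- F4_elements]].

(** In characteristic 2 the incidence y = m x + b also reads b = y + m x, so points
    and lines are treated alike.  The pair [(~~ s, s)] is the matching
    difference: 1 for points and w for lines. *)
Definition neighbours (v : vertex) : seq vertex :=
  let: (s, (x, y)) := v in
  (s, (x, F4_add y (~~ s, s))) ::
    [seq (~~ s, (m, F4_add y (F4_mul m x))) | m <- F4_elements].

Definition adjacent : rel vertex := fun u v => v \in neighbours u.

Lemma mem_vertices v : v \in vertices.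
Proof. by case: v => [[] [[[] []] [[] []]]]. Qed.

Lemma all_vertices (P : pred vertex) : all P vertices -> forall v, P v.
Proof. by move/allP=> Pall v; apply/Pall/mem_vertices. Qed.

Lemma all_edges (P : rel vertex) :
  all (fun u => all (P u) (neighbours u)) vertices ->
  forall u v, adjacent u v -> P u v.
Proof. by move/all_vertices=> Pall u v; apply/allP: v. Qed.

Lemma adjacent_sym : symmetric adjacent.
Proof.
suff adjC u v : adjacent u v -> adjacent v u.
  by move=> u v; apply/idP/idP; apply: adjC.
by move: u v; apply: (@all_edges (fun u v => adjacent v u)); vm_compute.
Qed.

Lemma adjacent_irr : irreflexive adjacent.
Proof.
by move=> u; apply/negbTE; move: u; apply: all_vertices; vm_compute.
Qed.

Lemma uniq_neighbours v : uniq (neighbours v).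
Proof. by move: v; apply: all_vertices; vm_compute. Qed.

(** For each of the 160 oriented edges, this says that it lies in no 3-cycle, in no
    4-cycle and in exactly twelve 5-cycles. *)
Lemma closing_walks_neighbours u v : adjacent u v ->
  [/\ closing_walks neighbours u 1 v = [::],
      closing_walks neighbours u 2 v = [::] &
      size (closing_walks neighbours u 3 v) = 12].
Proof.
move=> uv; pose c n := size (closing_walks neighbours u n v).
suff /and3P[/nilP ? /nilP ? /eqP ?] : [&& c 1 == 0, c 2 == 0 & c 3 == 12] by [].
by rewrite /c {c}; move: u v uv; apply: all_edges; vm_compute.
Qed.

Theorem theorem2p2 : exists (T : finType) (e : rel T), egr e 32 5 5 12.
Proof.
have card12 x y : adjacent x y ->
    #|[set C in graph_cycles adjacent 5 | [set x; y] \in C]| = 12.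
  move=> xy; rewrite card_cycles_through //.
  - by case: (closing_walks_neighbours xy).
  - exact: uniq_neighbours.
  - exact: adjacent_sym.
exists vertex, adjacent; split=> //.
- by split; [apply: adjacent_sym | apply: adjacent_irr].
- by rewrite !card_prod card_bool.
- move=> x; rewrite cardsE (card_uniqP (uniq_neighbours x)).
  by case: x => ? [].
split=> [|n].
  have uv : adjacent (false, ((false, false), (false, false)))
                     (false, ((false, false), (true, false))) by [].
  apply/eqP=> no5; have := card12 _ _ uv.
  by rewrite (eq_card0 (A := [set _ in _ | _])) // => C; rewrite no5 !inE.
case: n => [|[|[|[|[|//]]]]] _; try by apply/setP=> C; rewrite !inE.
- by apply: graph_cycles_eq0 => x y /closing_walks_neighbours[].
- by apply: graph_cycles_eq0 => x y /closing_walks_neighbours[].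
Qed.
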